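(* (1) An element $a\in\mathbb{I}_1$ admits a left inverse iff $a=a'\int^n$ for some natural number $n\ge0$ and an element $a'\in K^*+F$ such that $a_{K[x]}$ is an injection (necessarily, $n=\dim_K(\mathrm{coker}(a_{K[x]}))$). In this case, $\mathrm{l.inv}(a)=\{b=\partial^nb'\mid b'\in K^*+F,\ \int^n\partial^nb'a'\int^n\partial^n=\int^n\partial^n\}$. Moreover, $\mathcal{L}(\mathbb{I}_1)=\{a\in(K^*+F)\int^n\mid n\in\mathbb{N},\ a_{K[x]}\text{ is an injection}\}$. (2) An element $b\in\mathbb{I}_1$ admits a right inverse iff $b=\partial^nb'$ for some natural number $n\ge0$ and an element $b'\in K^*+F$ such that $b_{K[x]}$ is a surjection (necessarily, $n=\dim_K(\ker(b_{K[x]}))$). In this case, $\mathrm{r.inv}(b)=\{a'\int^n\mid a'\in K^*+F,\ \int^n\partial^nb'a'\int^n\partial^n=\int^n\partial^n\}$. Moreover, $\mathcal{R}(\mathbb{I}_1)=\{b\in\partial^n(K^*+F)\mid n\in\mathbb{N},\ b_{K[x]}\text{ is a surjection}\}$.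
   Context: $K$ is a field of characteristic zero, $K^*=K\setminus\{0\}$, $\mathbb{N}=\{0,1,\ldots\}$. $\mathbb{I}_1$ is the subalgebra of $\mathrm{End}_K(K[x])$ generated by (multiplication by) $x$, $\partial=\frac{d}{dx}$ and $\int: x^n\mapsto \frac{x^{n+1}}{n+1}$. Put $e_{ij}:=\int^i\partial^j-\int^{i+1}\partial^{j+1}$ ($i,j\ge0$) and $F:=\bigoplus_{i,j\ge0}Ke_{ij}$, an ideal of $\mathbb{I}_1$; $K^*+F=\{\lambda+f\mid\lambda\in K^*,f\in F\}$. For $a\in\mathbb{I}_1$, $a_{K[x]}:K[x]\to K[x]$, $p\mapsto ap$. $\mathcal{L}(\mathbb{I}_1):=\{a\in\mathbb{I}_1\mid ba=1\text{ for some }b\in\mathbb{I}_1\}$, $\mathcal{R}(\mathbb{I}_1):=\{b\in\mathbb{I}_1\mid ba=1\text{ for some }a\in\mathbb{I}_1\}$; for $u\in\mathbb{I}_1$, $\mathrm{l.inv}(u):=\{v\in\mathbb{I}_1\mid vu=1\}$ and $\mathrm{r.inv}(u):=\{v\in\mathbb{I}_1\mid uv=1\}$. *)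

(* Defs.v *)
From HB Require Import structures.
From mathcomp Require Import all_boot all_order all_algebra.
From mathcomp Require Import boolp classical_sets.

Set Implicit Arguments.
Unset Strict Implicit.
Unset Printing Implicit Defensive.

Import GRing.Theory.

Local Open Scope classical_set_scope.
Local Open Scope ring_scope.

(* The K-algebra End_K(K[x]), with composition as product. *)
Definition endo (K : fieldType) := {linear {poly K} -> {poly K}}.

Section EndoAlgebra.
Variable K : fieldType.
Implicit Types f g h : endo K.

Lemma endoP f g : f =1 g -> f = g.
Proof.
case: f g => [f cf] [g cg] /funext /= efg.
subst g; congr GRing.Linear.Pack.
case: cf cg => [[nf] [sf]] [[nf'] [sf']].
by rewrite (Prop_irrelevance nf nf') (Prop_irrelevance sf sf').
Qed.

HB.instance Definition _ := gen_eqMixin (endo K).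
HB.instance Definition _ := gen_choiceMixin (endo K).

Definition endo0 : endo K := \0.
Definition endo_opp f : endo K := \- f.
Definition endo_add f g : endo K := f \+ g.
Definition endo1 : endo K := idfun.
Definition endo_mul f g : endo K := f \o g.
Definition endo_scale (c : K) f : endo K := c \*: f.

Fact endo_addA : associative endo_add.
Proof. by move=> f g h; apply: endoP => v; apply: addrA. Qed.
Fact endo_addC : commutative endo_add.
Proof. by move=> f g; apply: endoP => v; apply: addrC. Qed.
Fact endo_add0 : left_id endo0 endo_add.
Proof. by move=> f; apply: endoP => v; apply: add0r. Qed.
Fact endo_addN : left_inverse endo0 endo_opp endo_add.
Proof. by move=> f; apply: endoP => v; apply: addNr. Qed.

HB.instance Definition _ := GRing.isZmodule.Build (endo K)
  endo_addA endo_addC endo_add0 endo_addN.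

Fact endo_mulA : associative endo_mul.
Proof. by move=> f g h; apply: endoP. Qed.
Fact endo_mul1 : left_id endo1 endo_mul.
Proof. by move=> f; apply: endoP. Qed.
Fact endo_mulr1 : right_id endo1 endo_mul.
Proof. by move=> f; apply: endoP. Qed.
Fact endo_mulDl : left_distributive endo_mul endo_add.
Proof. by move=> f g h; apply: endoP. Qed.
Fact endo_mulDr : right_distributive endo_mul endo_add.
Proof. by move=> f g h; apply: endoP => v; apply: linearD. Qed.

HB.instance Definition _ := GRing.Zmodule_isPzRing.Build (endo K)
  endo_mulA endo_mul1 endo_mulr1 endo_mulDl endo_mulDr.

Fact endo_oner_neq0 : (1 : endo K) != 0.
Proof.
apply/eqP => /(congr1 (fun f : endo K => f 1)) /= /eqP.
by rewrite oner_eq0.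
Qed.

HB.instance Definition _ := GRing.PzSemiRing_isNonZero.Build (endo K)
  endo_oner_neq0.

Fact endo_scaleA c d f : endo_scale c (endo_scale d f) = endo_scale (c * d) f.
Proof. by apply: endoP => v; apply: scalerA. Qed.
Fact endo_scale1 : left_id 1 endo_scale.
Proof. by move=> f; apply: endoP => v; apply: scale1r. Qed.
Fact endo_scaleDr : right_distributive endo_scale +%R.
Proof. by move=> c f g; apply: endoP => v; apply: scalerDr. Qed.
Fact endo_scaleDl f : {morph endo_scale^~ f : c d / c + d}.
Proof. by move=> c d; apply: endoP => v; apply: scalerDl. Qed.

HB.instance Definition _ := GRing.Zmodule_isLmodule.Build K (endo K)
  endo_scaleA endo_scale1 endo_scaleDr endo_scaleDl.

Fact endo_scaleAl (c : K) f g : c *: (f * g) = c *: f * g.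
Proof. exact: endoP. Qed.
HB.instance Definition _ := GRing.Lmodule_isLalgebra.Build K (endo K)
  endo_scaleAl.

Fact endo_scaleAr (c : K) f g : c *: (f * g) = f * (c *: g).
Proof. by apply: endoP => v; symmetry; exact: linearZ_LR. Qed.
HB.instance Definition _ := GRing.Lalgebra_isAlgebra.Build K (endo K)
  endo_scaleAr.

End EndoAlgebra.

Section IntegroDifferential.
Variable K : fieldType.

Definition integral (p : {poly K}) : {poly K} :=
  \sum_(i < size p) (p`_i / i.+1%:R) *: 'X^(i.+1).

Lemma coef_integral p k :
  (integral p)`_k = if k is i.+1 then p`_i / i.+1%:R else 0.
Proof.
rewrite coef_sum; case: k => [|k].
  by apply: big1 => i _; rewrite coefZ coefXn mulr0.
have [ltk|lek] := ltnP k (size p); last first.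
  rewrite nth_default // mul0r; apply: big1 => i _.
  by rewrite coefZ coefXn eqSS gtn_eqF ?mulr0 // (leq_trans (ltn_ord i)).
rewrite (bigD1 (Ordinal ltk)) //= coefZ coefXn eqxx mulr1 big1 ?addr0 //.
by move=> i neik; rewrite coefZ coefXn eqSS eq_sym [_ == _](negbTE neik) mulr0.
Qed.

Fact integral_is_linear : linear integral.
Proof.
move=> c p q; apply/polyP => -[|k];
  rewrite coefD coefZ !coef_integral ?mulr0 ?addr0 //.
by rewrite coefD coefZ mulrDl mulrA.
Qed.
HB.instance Definition _ := GRing.isLinear.Build K {poly K} {poly K} _ integral
  integral_is_linear.

Lemma integralXn n : integral 'X^n = n.+1%:R^-1 *: 'X^(n.+1).
Proof.
apply/polyP => -[|k]; rewrite coef_integral coefZ !coefXn ?mulr0 // eqSS.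
by case: eqP => [->|_]; rewrite ?mulr1 ?mul1r // mul0r mulr0.
Qed.

Definition opX : endo K := 'X \*o idfun.
Definition opD : endo K := @deriv K.
Definition opI : endo K := integral.

Definition I1 : set (endo K) :=
  smallest (fun S : set (endo K) => GRing.subalg_closed [in S])
    [set opX; opD; opI].

Definition eI (i j : nat) : endo K :=
  opI ^+ i * opD ^+ j - opI ^+ i.+1 * opD ^+ j.+1.

Definition idealF : set (endo K) :=
  [set f | exists n (c : 'M[K]_n), f = \sum_i \sum_j c i j *: eI i j].

(* K^* + F, where F is idealF *)
Definition KF : set (endo K) :=
  [set a | exists2 c : K, c != 0 & exists2 f, idealF f & a = c%:A + f].

Definition linv (u : endo K) : set (endo K) := [set v | I1 v /\ v * u = 1].
Definition rinv (u : endo K) : set (endo K) := [set v | I1 v /\ u * v = 1].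

Definition LI1 : set (endo K) := [set a | I1 a /\ exists2 b, I1 b & b * a = 1].
Definition RI1 : set (endo K) := [set b | I1 b /\ exists2 a, I1 a & b * a = 1].

End IntegroDifferential.

Arguments opX {K}.
Arguments opD {K}.
Arguments opI {K}.
Arguments eI {K} i j.
Arguments I1 {K}.
Arguments idealF {K}.
Arguments KF {K}.
Arguments LI1 {K}.
Arguments RI1 {K}.

(* For subspaces W and U of V with W included in U: some family e_0, ...,
   e_(n-1) of U induces a basis of U / W. This is a relation, as dim (U / W)
   may be infinite. *)
Definition dim_quotient (K : fieldType) (V : lmodType K) (U W : set V)
    (n : nat) :=
  exists e : 'I_n -> V,
    [/\ forall i, U (e i),
       forall u, U u -> exists c : 'I_n -> K, W (u - \sum_i c i *: e i)
     & forall c : 'I_n -> K, W (\sum_i c i *: e i) -> forall i, c i = 0].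

Definition dim_ker (K : fieldType) (a : endo K) (n : nat) :=
  dim_quotient [set p | a p = 0] [set 0] n.

Definition dim_coker (K : fieldType) (a : endo K) (n : nat) :=
  dim_quotient setT (range a) n.

(* Main.v *)
From HB Require Import structures.
Require Import Defs.
From mathcomp Require Import all_boot all_order all_algebra.
From mathcomp Require Import boolp classical_sets.
From mathcomp Require Import zify ring.
Import Order.TTheory GRing.Theory Num.Theory.

Local Open Scope classical_set_scope.
Local Open Scope ring_scope.

(** Everything is read off in the divided-power basis e_s = x^s/s! of K[x], where
    the differentiation operator sends e_s to e_(s-1), integration sends e_s to
    e_(s+1), and e_ij is the matrix unit sending e_j to e_i. Hence F consists of
    the endomorphisms killing e_s for all large s, and K^* + F of those acting on
    e_s as a fixed nonzero scalar for all large s (lemma [KF_eshift]). More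
    generally, call an endomorphism an eventual shift when it sends e_(s+m) to
    lam e_(s+n) for all large s. With lam nonzero, those with (m,n) = (0,d) form
    the set (K^* + F) int^d ([KF_opI_eshift]), and those with (m,n) = (d,0) form
    the set D^d (K^* + F), where D is differentiation ([opD_KF_eshift]).

    Two facts then prove the theorem.

    - One-sided inverses inside I_1 are eventual shifts ([I1_inverse_eshift]). An
      element of I_1 sends e_s, for large s, to the sum over k of p_k(s) e_(s+k)
      for finitely many polynomials p_k: its image in I_1/F, a ring of skew
      Laurent polynomials, written out concretely. If b a = 1, compare the terms
      of highest shift in b and a, and then those of lowest shift: each product
      of extreme coefficients is a product of nonzero polynomials, hence nonzero,
      so its total shift must be 0 and its value 1. Therefore a and b each
      involve a single shift, with constant coefficient.

    - An eventual shift with lam nonzero is a finite matrix, from the span of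
      e_0, ..., e_(k-1) to that of e_0, ..., e_(l-1), together with an honest
      shift on the remaining basis vectors ([eshift_blockP]). Injectivity and
      surjectivity are those of the matrix, so one-sided inverses and the
      dimension of the kernel come from finite linear algebra
      ([eshift_injective], [eshift_surjective]). The inverses found in this way
      are eventual shifts again, hence lie in I_1.

    The index n is determined by the eventual shift ([eshift_index]); this gives
    the description of all left or right inverses, and the dimension of the
    cokernel of a is that of the kernel of any left inverse. *)

Set Implicit Arguments.
Unset Strict Implicit.

Section CharacteristicZero.
Variable K : fieldType.
Hypothesis charK : [pchar K] =i pred0.
Implicit Types (a b f : endo K) (p q : {poly K}) (lam mu : K).

(** * The divided-power basis of K[x] *)

(** The ring operations on endomorphisms are packed structures that rewriting
    does not see through, hence these evaluation rules. *)
Lemma endoE_add a b p : (a + b) p = a p + b p. Proof. by []. Qed.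
Lemma endoE_sub a b p : (a - b) p = a p - b p. Proof. by []. Qed.
Lemma endoE_scale c a p : (c *: a) p = c *: a p. Proof. by []. Qed.
Lemma endoE_mul a b p : (a * b) p = a (b p). Proof. by []. Qed.
Lemma endoE_one p : (1 : endo K) p = p. Proof. by []. Qed.

Lemma endoE_sum (I : Type) (r : seq I) (P : pred I) (F : I -> endo K) p :
  (\sum_(i <- r | P i) F i) p = \sum_(i <- r | P i) F i p.
Proof. by elim/big_rec2: _ => // i u v _ <-. Qed.

Lemma endoZ a c p : a (c *: p) = c *: a p. Proof. exact: linearZ. Qed.

Definition endoE := (endoE_sum, endoE_add, endoE_sub, endoE_scale,
  endoE_mul, endoE_one).

Lemma natf_neq0_char0 n : (n.+1%:R : K) != 0.
Proof. by have /pcharf0P -> := charK. Qed.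

Lemma factf_neq0 n : (n`!%:R : K) != 0.
Proof. by case: n`! (fact_gt0 n) => // m _; apply: natf_neq0_char0. Qed.

(** Locked, since rewriting with linearity would otherwise unfold the scalar
    hidden in [dpow]. *)
Definition dpow (s : nat) : {poly K} := locked (s`!%:R^-1 *: 'X^s).
(** The coordinate along [dpow t]. *)
Definition dcoef (t : nat) p : K := p`_t * t`!%:R.

Fact dcoef_is_scalar t : scalar (dcoef t).
Proof. by move=> c p q; rewrite /dcoef coefD coefZ mulrDl mulrA. Qed.
HB.instance Definition _ t :=
  GRing.isLinear.Build K {poly K} K _ (dcoef t) (dcoef_is_scalar t).

Lemma dcoefP p q : (forall t, dcoef t p = dcoef t q) -> p = q.
Proof.
by move=> e; apply/polyP=> t; apply: (mulIf (factf_neq0 t)); apply: e.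
Qed.

Lemma dcoef_dpow t s : dcoef t (dpow s) = (t == s)%:R.
Proof.
rewrite /dcoef /dpow -lock coefZ coefXn; case: eqP => [->|_];
  last by rewrite mulr0 mul0r.
by rewrite mulr1 mulVf ?factf_neq0.
Qed.

Lemma dcoef_ge_size t p : (size p <= t)%N -> dcoef t p = 0.
Proof. by move=> h; rewrite /dcoef nth_default ?mul0r. Qed.

Lemma poly_dpow n p : (size p <= n)%N -> p = \sum_(i < n) dcoef i p *: dpow i.
Proof.
move=> hn; apply: dcoefP => t; rewrite linear_sum /=.
under eq_bigr do rewrite linearZ /= dcoef_dpow.
have [h|h] := ltnP t n; last first.
  rewrite dcoef_ge_size ?big1 ?(leq_trans hn) // => i _.
  by rewrite [_ == _]gtn_eqF ?mulr0 ?(leq_trans (ltn_ord i)).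
rewrite (bigD1 (Ordinal h)) //= eqxx mulr1 big1 ?addr0 // => i ni.
by rewrite eq_sym [_ == _](negbTE ni) mulr0.
Qed.

Lemma endo_eqP a b : (forall s, a (dpow s) = b (dpow s)) -> a = b.
Proof.
move=> e; apply: endoP => p; rewrite (poly_dpow (leqnn (size p))) !linear_sum.
by apply: eq_bigr => i _; rewrite !endoZ e.
Qed.

Lemma dcoef_opX t p : dcoef t.+1 (opX p) = t.+1%:R * dcoef t p.
Proof. by rewrite /dcoef /= coefXM factS natrM /=; ring. Qed.
Lemma dcoef0_opX p : dcoef 0 (opX p) = 0.
Proof. by rewrite /dcoef /= coefXM mul0r. Qed.

Lemma dcoef_opD t p : dcoef t (opD p) = dcoef t.+1 p.
Proof.
by rewrite /dcoef /= coef_deriv factS natrM -(mulr_natr p`_t.+1) mulrA.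
Qed.

Lemma dcoef_opI t p : dcoef t.+1 (opI p) = dcoef t p.
Proof.
rewrite /dcoef /= coef_integral factS natrM mulrA; congr (_ * _).
by rewrite mulfVK ?natf_neq0_char0.
Qed.
Lemma dcoef0_opI p : dcoef 0 (opI p) = 0.
Proof. by rewrite /dcoef /= coef_integral mul0r. Qed.

Lemma dcoef_opDn n t p : dcoef t ((opD ^+ n) p) = dcoef (t + n) p.
Proof.
elim: n t p => [|n IH] t p; first by rewrite addn0.
by rewrite exprS endoE dcoef_opD IH addSnnS.
Qed.

Lemma dcoef_opIn n t p :
  dcoef t ((opI ^+ n) p) = if (t < n)%N then 0 else dcoef (t - n) p.
Proof.
elim: n t p => [|n IH] [|t] p; rewrite ?subn0 // exprS endoE.
  by rewrite dcoef0_opI.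
by rewrite dcoef_opI IH ltnS subSS.
Qed.

Lemma opDnE n s : (opD ^+ n) (dpow s) = if (s < n)%N then 0 else dpow (s - n).
Proof.
apply: dcoefP => t; rewrite dcoef_opDn dcoef_dpow; case: ifP => h.
  by rewrite linear0 gtn_eqF //; lia.
by rewrite dcoef_dpow; congr ((_ : bool)%:R); lia.
Qed.

Lemma opInE n s : (opI ^+ n) (dpow s) = dpow (s + n).
Proof.
apply: dcoefP => t; rewrite dcoef_opIn !dcoef_dpow; case: ifP => h.
  by rewrite ltn_eqF //; lia.
by congr ((_ : bool)%:R); lia.
Qed.

Lemma opDnIn n : opD ^+ n * opI ^+ n = 1 :> endo K.
Proof.
apply: endo_eqP => s.
by rewrite !endoE opInE opDnE ltnNge leq_addl /= addnK.
Qed.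

(** The two terms of e_ij agree on all dual coordinates except the i-th, where
    only the first survives. *)
Lemma eIE i j p : eI i j p = dcoef j p *: dpow i.
Proof.
apply: dcoefP => t; rewrite /eI !endoE linearB linearZ /= dcoef_dpow.
rewrite !dcoef_opIn !dcoef_opDn ltnS.
have [h|h|->] := ltngtP t i; rewrite ?subrr ?mulr0 //.
  by rewrite -subnSK // addSnnS subrr.
by rewrite subnn add0n subr0 mulr1.
Qed.

(** * Finite matrices extended by a shift *)

Definition lincomb k (v : 'rV[K]_k) : {poly K} := \sum_(i < k) v 0 i *: dpow i.
Definition coords k p : 'rV[K]_k := \row_i dcoef i p.

Lemma dcoef_lincomb k (v : 'rV_k) (i : 'I_k) : dcoef i (lincomb v) = v 0 i.
Proof.
rewrite linear_sum (bigD1 i) //= linearZ /= dcoef_dpow eqxx mulr1.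
rewrite big1 ?addr0 // => j nji; rewrite linearZ /= dcoef_dpow.
by rewrite eq_sym [_ == _](negbTE nji) mulr0.
Qed.

Lemma dcoef_lincomb_ge k (v : 'rV_k) t : (k <= t)%N -> dcoef t (lincomb v) = 0.
Proof.
move=> h; rewrite linear_sum big1 //= => j _; rewrite linearZ /= dcoef_dpow.
by rewrite gtn_eqF ?mulr0 // (leq_trans (ltn_ord j)).
Qed.

Lemma lincomb0 k : lincomb (0 : 'rV_k) = 0.
Proof. by rewrite /lincomb big1 // => i _; rewrite mxE scale0r. Qed.

Lemma lincombK k : cancel (@lincomb k) (coords k).
Proof. by move=> v; apply/rowP=> i; rewrite mxE dcoef_lincomb. Qed.

Lemma coords0 k : coords k 0 = 0.
Proof. by apply/rowP => i; rewrite !mxE linear0. Qed.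

Lemma coords_block k (v : 'rV_k) q : coords k (lincomb v + (opI ^+ k) q) = v.
Proof.
apply/rowP => i; rewrite mxE linearD /= dcoef_lincomb.
by rewrite dcoef_opIn ltn_ord addr0.
Qed.

Lemma opDn_block k (v : 'rV_k) q : (opD ^+ k) (lincomb v + (opI ^+ k) q) = q.
Proof.
apply: dcoefP => t; rewrite dcoef_opDn linearD /= dcoef_lincomb_ge ?leq_addl //.
by rewrite dcoef_opIn ltnNge leq_addl /= addnK add0r.
Qed.

(** Taylor expansion at 0 with remainder: int^k D^k is the projection that kills
    [dpow 0], ..., [dpow (k - 1)] and fixes the later basis vectors. *)
Lemma taylor k p : p = lincomb (coords k p) + (opI ^+ k) ((opD ^+ k) p).
Proof.
apply: dcoefP => t; rewrite linearD /= dcoef_opIn dcoef_opDn.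
have [h|h] := ltnP t k.
  by rewrite (dcoef_lincomb _ (Ordinal h)) mxE addr0.
by rewrite dcoef_lincomb_ge // add0r subnK.
Qed.

(** The operator acting by the matrix [G] from the first [k] basis vectors to the
    first [l], and sending [dpow (k + s)] to [lam *: dpow (l + s)]. Matrices act on
    row vectors on the right, hence the transposed indices. *)
Definition block k l (G : 'M[K]_(k, l)) lam : endo K :=
  \sum_i \sum_j G i j *: eI j i + lam *: (opI ^+ l * opD ^+ k).

Lemma blockE k l (G : 'M_(k, l)) lam p :
  block G lam p =
    lincomb (coords k p *m G) + (opI ^+ l) (lam *: (opD ^+ k) p).
Proof.
rewrite /block !endoE endoZ; congr (_ + _).
rewrite /lincomb; under [RHS]eq_bigr => j _ do rewrite mxE scaler_suml.
rewrite exchange_big /=; apply: eq_bigr => i _; rewrite endoE.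
by apply: eq_bigr => j _; rewrite endoE eIE scalerA mxE mulrC.
Qed.

Lemma block_lincomb k l (G : 'M_(k, l)) lam (v : 'rV_k) :
  block G lam (lincomb v) = lincomb (v *m G).
Proof.
have := coords_block v 0; have := opDn_block v 0.
by rewrite linear0 addr0 blockE => -> ->; rewrite scaler0 linear0 addr0.
Qed.

(** The finite part and the tail of a block operator do not interact. *)
Lemma block_mul k l r (G : 'M_(k, l)) (H : 'M_(l, r)) lam mu :
  block H mu * block G lam = block (G *m H) (lam * mu).
Proof.
apply: endoP => p; rewrite endoE !blockE coords_block opDn_block.
by rewrite mulmxA scalerA mulrC.
Qed.

Lemma block_1 k : block (1%:M : 'M_k) 1 = 1.
Proof. by apply: endoP => p; rewrite blockE mulmx1 scale1r -taylor. Qed.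

(** A vector in the row kernel of [G] is a polynomial killed by the operator. *)
Lemma injective_block k l (G : 'M_(k, l)) lam :
  injective (block G lam) -> row_free G.
Proof.
move=> inj; rewrite -kermx_eq0; apply/eqP/row_matrixP => i.
set v := row i _.
have vG : v *m G = 0 by rewrite -row_mul mulmx_ker row0.
have /inj/(congr1 (coords k)) : block G lam (lincomb v) = block G lam 0.
  by rewrite block_lincomb vG lincomb0 linear0.
by rewrite lincombK coords0 row0.
Qed.

(** The tail of a preimage never contributes to the first [l] coordinates, so the
    matrix alone must reach all of them. *)
Lemma surjective_block k l (G : 'M_(k, l)) lam :
  (forall q, exists p, block G lam p = q) -> row_full G.
Proof.
move=> surj; rewrite -sub1mx; apply/row_subP => i.
have [p] := surj (lincomb (row i 1%:M)).
move/(congr1 (coords l)); rewrite blockE coords_block lincombK => <-.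
exact: submxMl.
Qed.

Lemma block_left_inverse k l (G : 'M_(k, l)) lam :
    lam != 0 -> injective (block G lam) ->
  exists H : 'M_(l, k), block H lam^-1 * block G lam = 1.
Proof.
move=> lam0 /injective_block/row_freeP[H GH1]; exists H.
by rewrite block_mul GH1 divff // block_1.
Qed.

Lemma block_right_inverse k l (G : 'M_(k, l)) lam :
    lam != 0 -> (forall q, exists p, block G lam p = q) ->
  exists H : 'M_(l, k), block G lam * block H lam^-1 = 1.
Proof.
move=> lam0 /surjective_block/row_fullP[H HG1]; exists H.
by rewrite block_mul HG1 mulVf // block_1.
Qed.

(** The shift on the tail is injective, so the kernel lies in the span of the first
    [k] basis vectors, where it is the row kernel of [G]; as [G] has full rank [l],
    this kernel has dimension [k - l]. *)
Lemma dim_ker_block k l (G : 'M_(k, l)) lam :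
    lam != 0 -> (forall q, exists p, block G lam p = q) ->
  dim_ker (block G lam) (k - l).
Proof.
move=> lam0 /surjective_block/eqP rG.
have -> : (k - l)%N = \rank (kermx G) by rewrite mxrank_ker rG.
set B := row_base (kermx G).
have lincombZ (c : 'I_(\rank (kermx G)) -> K) :
    \sum_i c i *: lincomb (row i B) = lincomb (\row_i c i *m B).
  rewrite /lincomb; under eq_bigr do rewrite scaler_sumr.
  rewrite exchange_big; apply: eq_bigr => j _ /=.
  by rewrite mxE scaler_suml; apply: eq_bigr => i _; rewrite !mxE scalerA.
have BG : B *m G = 0 by apply/sub_kermxP; rewrite eq_row_base.
exists (fun i => lincomb (row i B)); split=> [i /=|u /= u0|c /=].
- apply: etrans (block_lincomb _ _ _) _.
  by rewrite -row_mul BG row0 lincomb0.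
- have {}u0 := etrans (esym (blockE G lam u)) u0.
  have uG : coords k u *m G = 0.
    by move/(congr1 (coords l)): u0; rewrite coords_block coords0.
  have /eqP := congr1 (opD ^+ l : endo K) u0.
  rewrite opDn_block linear0 scaler_eq0 (negbTE lam0) /= => /eqP Du.
  have /submxP[c uc] : (coords k u <= B)%MS.
    by rewrite eq_row_base; apply/sub_kermxP.
  exists (fun i => c 0 i); rewrite lincombZ [u in u - _](taylor k) Du.
  rewrite linear0 addr0 uc; apply/eqP; rewrite subr_eq0; apply/eqP.
  by congr (lincomb (_ *m _)); apply/rowP => i; rewrite mxE.
rewrite lincombZ => c0 i.
move/(congr1 (coords k)): c0; rewrite lincombK coords0 => cB.
have /row_freeP[C BC] : row_free B by apply: row_base_free.
have /rowP/(_ i) : \row_i c i = 0.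
  by rewrite -[LHS]mulmx1 -BC mulmxA cB mul0mx.
by rewrite !mxE.
Qed.

(** * Eventual shifts *)

(** The constant [n - m] is the amount of the shift; two naturals avoid signs and
    make composition a matter of matching indices. *)
Definition eshift lam m n a :=
  exists N, forall s, (N <= s)%N -> a (dpow (s + m)) = lam *: dpow (s + n).

Lemma eshift_reindex lam m n m' n' a :
  (m + n' = m' + n)%N -> eshift lam m n a -> eshift lam m' n' a.
Proof.
move=> e [N aN]; exists (N + m)%N => s hs.
have -> : (s + m' = s + m' - m + m)%N by lia.
by rewrite aN; last lia; congr (_ *: dpow _); lia.
Qed.

Lemma eshift_mul lam mu m n k a b :
  eshift lam m n a -> eshift mu n k b -> eshift (lam * mu) m k (b * a).
Proof.
move=> [N aN] [M bM]; exists (maxn N M) => s; rewrite geq_max => /andP[hN hM].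
by rewrite endoE aN // endoZ bM // scalerA.
Qed.

Lemma eshift_opIn n : eshift 1 0 n (opI ^+ n).
Proof. by exists 0%N => s _; rewrite opInE scale1r addn0. Qed.

Lemma eshift_opDn n : eshift 1 n 0 (opD ^+ n).
Proof.
by exists 0%N => s _; rewrite opDnE ltnNge leq_addl /= addnK scale1r addn0.
Qed.

Lemma eshift_index lam mu m n m' n' a :
    lam != 0 -> eshift lam m n a -> eshift mu m' n' a ->
  (m + n' = m' + n)%N.
Proof.
move=> lam0 [N aN] [M aM]; pose s := (N + M)%N.
have := aN (s + m')%N; have := aM (s + m)%N.
rewrite (_ : s + m' + m = s + m + m')%N; last lia.
move=> -> => [|]; last lia.
move=> /(_ ltac:(lia))/(congr1 (dcoef (s + m' + n))).
rewrite !linearZ /= !dcoef_dpow eqxx mulr1.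
case: eqP => [e _|_]; first lia.
by rewrite mulr0 => e; move: lam0; rewrite -e eqxx.
Qed.

(** Cutting at a [k] beyond both the start of the shift and the degrees of the
    images of the exceptional basis vectors leaves a finite matrix. *)
Lemma eshift_blockP lam m n a :
  eshift lam m n a <->
    exists k l (G : 'M_(k, l)), (k + n = l + m)%N /\ a = block G lam.
Proof.
split=> [[N aN]|[k [l [G [e ->]]]]]; last first.
  have e' : (k + n = m + l)%N by lia.
  apply: (eshift_reindex e'); exists 0%N => s _.
  rewrite blockE opDnE ltnNge leq_addl addnK /= endoZ opInE.
  suff -> : coords k (dpow (s + k)) = 0 by rewrite mul0mx lincomb0 add0r.
  apply/rowP => i; rewrite !mxE dcoef_dpow ltn_eqF //.
  by rewrite (leq_trans (ltn_ord i)) ?leq_addl.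
(* bounds the size of the images of the basis vectors below [N + m] *)
pose R := \max_(i < N + m) size (a (dpow i)).
pose k := (N + R + m)%N; pose l := (N + R + n)%N.
exists k, l, (\matrix_(i, j) dcoef j (a (dpow i))); split; first by lia.
apply: endo_eqP => s; rewrite blockE opDnE.
have [h|h] := ltnP s k; last first.
  have -> : coords k (dpow s) = 0.
    apply/rowP => i; rewrite !mxE dcoef_dpow ltn_eqF //.
    by rewrite (leq_trans (ltn_ord i)).
  rewrite mul0mx lincomb0 add0r endoZ opInE.
  have {1}-> : s = (s - m + m)%N by lia.
  by rewrite aN; [congr (_ *: dpow _)|]; lia.
have sl : (size (a (dpow s)) <= l)%N.
  have [sN|sN] := ltnP s (N + m).
    have := @leq_bigmax _ (fun i : 'I_(N + m) => size (a (dpow i))) (Ordinal sN).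
    by rewrite -/R /=; lia.
  have {1}-> : s = (s - m + m)%N by lia.
  rewrite aN; last lia.
  rewrite (leq_trans (size_scale_leq _ _)) // /dpow -lock.
  by rewrite (leq_trans (size_scale_leq _ _)) // size_polyXn; lia.
rewrite scaler0 linear0 addr0 [LHS](poly_dpow sl); apply: eq_bigr => j _.
congr (_ *: _); rewrite mxE (bigD1 (Ordinal h)) //= !mxE dcoef_dpow eqxx mul1r.
rewrite big1 ?addr0 // => i ni; rewrite !mxE dcoef_dpow [_ == _](negbTE ni).
by rewrite mul0r.
Qed.

Lemma idealF_eshift f : idealF f <-> eshift 0 0 0 f.
Proof.
rewrite eshift_blockP; split=> [[n [c ->]]|[k [l [G [e ->]]]]].
  exists n, n, c^T; split=> //; rewrite /block scale0r addr0 exchange_big.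
  by apply: eq_bigr => i _; apply: eq_bigr => j _; rewrite mxE.
move: e; rewrite !addn0 => e; case: _ / e G => G.
exists k, G^T; rewrite /block scale0r addr0 exchange_big.
by apply: eq_bigr => i _; apply: eq_bigr => j _; rewrite mxE.
Qed.

Lemma KF_eshift a : KF a <-> exists2 lam, lam != 0 & eshift lam 0 0 a.
Proof.
split=> [[c c0 [f /idealF_eshift[N fN] ->]]|[c c0 [N aN]]]; exists c => //.
  by exists N => s hs; rewrite endoE fN // scale0r addr0 addn0 endoE.
exists (a - c%:A); last by rewrite addrC subrK.
apply/idealF_eshift; exists N => s hs.
by rewrite !endoE aN // addn0 subrr scale0r.
Qed.

(** Given [a], the factor is recovered as [a * opD ^+ n], since D^n int^n = 1. *)
Lemma KF_opI_eshift n a :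
  (exists2 a', KF a' & a = a' * opI ^+ n) <->
    exists2 lam, lam != 0 & eshift lam 0 n a.
Proof.
split=> [[a' /KF_eshift[lam lam0 a'S] ->]|[lam lam0 aS]].
  exists lam => //; rewrite -[lam]mul1r; apply: eshift_mul (eshift_opIn n) _.
  by apply: eshift_reindex a'S; rewrite addnC.
exists (a * opD ^+ n); last by rewrite -mulrA opDnIn mulr1.
apply/KF_eshift; exists lam => //.
have /eshift_reindex := eshift_mul (eshift_opDn n) aS; rewrite mul1r.
by apply; rewrite addn0.
Qed.

Lemma opD_KF_eshift n b :
  (exists2 b', KF b' & b = opD ^+ n * b') <->
    exists2 lam, lam != 0 & eshift lam n 0 b.
Proof.
split=> [[b' /KF_eshift[lam lam0 b'S] ->]|[lam lam0 bS]].
  exists lam => //; rewrite -[lam]mulr1; apply: eshift_mul (eshift_opDn n).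
  by apply: eshift_reindex b'S; rewrite addnC.
exists (opI ^+ n * b); last by rewrite mulrA opDnIn mul1r.
apply/KF_eshift; exists lam => //.
have /eshift_reindex := eshift_mul bS (eshift_opIn n); rewrite mulr1.
by apply; rewrite addn0.
Qed.

(** An injective finite matrix has at least as many columns as rows, whence
    [m <= n], and its right inverse matrix extends to a left inverse operator. *)
Lemma eshift_injective lam m n a :
    lam != 0 -> eshift lam m n a -> injective a ->
  (m <= n)%N /\ exists2 b, eshift lam^-1 n m b & b * a = 1.
Proof.
move=> lam0 /eshift_blockP[k [l [G [e ->]]]] inj; split.
  by have /eqP rG := injective_block inj; have := rank_leq_col G; lia.
have [H HG] := block_left_inverse lam0 inj; exists (block H lam^-1) => //.
by apply/eshift_blockP; exists l, k, H; split=> //; lia.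
Qed.

Lemma eshift_surjective lam m n b :
    lam != 0 -> eshift lam m n b -> (forall q, exists p, b p = q) ->
  [/\ (n <= m)%N, dim_ker b (m - n)
    & exists2 a, eshift lam^-1 n m a & b * a = 1].
Proof.
move=> lam0 /eshift_blockP[k [l [G [e ->]]]] surj; split.
- by have /eqP rG := surjective_block surj; have := rank_leq_row G; lia.
- by rewrite (_ : m - n = k - l)%N; [apply: dim_ker_block|lia].
have [H GH] := block_right_inverse lam0 surj; exists (block H lam^-1) => //.
by apply/eshift_blockP; exists l, k, H; split=> //; lia.
Qed.

(** When [b * a = 1], the idempotent [a * b] splits K[x] as the range of [a] plus
    the kernel of [b], so a basis of the latter is one of the cokernel of [a]. *)
Lemma dim_coker_left_inverse a b n : b * a = 1 -> dim_ker b n -> dim_coker a n.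
Proof.
move=> ba1 [e [kere gene freee]].
have bK p : b (a p) = p by have := congr1 (fun f : endo K => f p) ba1.
exists e; split=> // [u _|c [w _ aw]].
  have [|c uc] := gene (u - a (b u)); first by rewrite /mkset linearB bK subrr.
  exists c; exists (b u) => //.
  by move/eqP: uc; rewrite subr_eq0 => /eqP <-; rewrite opprB addrC subrK.
suff w0 : w = 0 by apply: freee; rewrite /mkset -aw w0 linear0.
rewrite -[w]bK aw linear_sum big1 // => i _.
by rewrite endoZ (kere i) scaler0.
Qed.

(** * Symbols of elements of I_1 *)

Lemma natr_inj_char0 : injective (fun n => n%:R : K).
Proof.
suff H m n : (m <= n)%N -> m%:R = n%:R :> K -> m = n.
  by move=> m n e; case: (leqP m n) => [|/ltnW] h; [|symmetry]; apply: H.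
move=> mn /esym/eqP; rewrite -subr_eq0 -natrB //.
case: (n - m)%N (subnKC mn) => [<-|d _]; first by rewrite addn0.
by rewrite (negbTE (natf_neq0_char0 d)).
Qed.

Lemma poly_eq_large N p q :
  (forall s, (N <= s)%N -> p.[s%:R] = q.[s%:R]) -> p = q.
Proof.
move=> e; apply/eqP; rewrite -subr_eq0; apply/negPn/negP => nz.
pose rs := [seq n%:R : K | n <- iota N (size (p - q))].
have rs_root : all (root (p - q)) rs.
  apply/allP => _ /mapP[n + ->]; rewrite mem_iota => /andP[hn _].
  by rewrite /root hornerD hornerN e // subrr.
have rs_uniq : uniq rs.
  by rewrite map_inj_uniq ?iota_uniq //; apply: natr_inj_char0.
by have := max_poly_roots nz rs_root rs_uniq; rewrite size_map size_iota ltnn.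
Qed.

(** The family [p] is the class of [a] modulo F, seen as a skew Laurent polynomial:
    the operator sends [dpow s] to the sum of the [(p k).[s] *: dpow (s + k)] for
    large [s]. *)
Definition has_symbol a (p : int -> {poly K}) :=
  (exists B, forall k : int, (B < `|k|)%N -> p k = 0) /\
  (exists N, forall s t, (N <= s)%N ->
     dcoef t (a (dpow s)) = (p (t%:Z - s%:Z)).[s%:R]).

Lemma has_symbol1 : has_symbol 1 (fun k => (k == 0)%:R).
Proof.
split; first by exists 0%N => k; case: eqP => // ->.
exists 0%N => s t _; rewrite endoE dcoef_dpow (_ : _ - _ == _ = (t == s)).
  by case: eqP; rewrite ?hornerC ?horner0.
by lia.
Qed.

(** Multiplication by x sends e_t to (t+1) e_(t+1); reaching shift [k] from the
    vector e_s means t + 1 = s + k, hence the factor ['X + k]. *)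
Lemma has_symbol_opX a (p : int -> {poly K}) : has_symbol a p ->
  has_symbol (opX * a) (fun k => p (k - 1) * ('X + (k%:~R)%:P)).
Proof.
move=> [[B pB] [N aN]]; split.
  by exists B.+1 => k hk; rewrite pB ?mul0r //; lia.
exists N => s [|t] hs; rewrite endoE hornerM hornerD hornerX hornerC.
  by rewrite dcoef0_opX sub0r rmorphN /= -pmulrn subrr mulr0.
rewrite dcoef_opX aN // (_ : t.+1%:Z - s%:Z - 1 = t%:Z - s%:Z); last by lia.
by rewrite rmorphB /= -!pmulrn [s%:R + _]addrC subrK mulrC.
Qed.

Lemma has_symbol_opD a (p : int -> {poly K}) : has_symbol a p ->
  has_symbol (opD * a) (fun k => p (k + 1)).
Proof.
move=> [[B pB] [N aN]]; split; first by exists B.+1 => k hk; rewrite pB //; lia.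
exists N => s t hs; rewrite endoE dcoef_opD aN //; congr (p _).[_]; lia.
Qed.

Lemma has_symbol_opI a (p : int -> {poly K}) : has_symbol a p ->
  has_symbol (opI * a) (fun k => p (k - 1)).
Proof.
move=> [[B pB] [N aN]]; split; first by exists B.+1 => k hk; rewrite pB //; lia.
(* beyond [B] no term of negative degree remains for integration to kill *)
exists (N + B)%N => s [|t] hs; rewrite endoE.
  by rewrite dcoef0_opI pB ?horner0 //; lia.
by rewrite dcoef_opI aN; [congr (p _).[_]|]; lia.
Qed.

Lemma has_symbol_lin c a b (p q : int -> {poly K}) :
    has_symbol a p -> has_symbol b q ->
  has_symbol (c *: a + b) (fun k => c *: p k + q k).
Proof.
move=> [[B pB] [N aN]] [[C qC] [M bM]]; split.
  by exists (B + C)%N => k hk; rewrite pB ?qC ?scaler0 ?addr0 //; lia.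
exists (N + M)%N => s t hs.
rewrite !endoE linearD linearZ /= aN ?bM; try lia.
by rewrite hornerD hornerZ.
Qed.

(** The operators whose left multiplication preserves the existence of a symbol
    form a subalgebra for free, so only the three generators need be examined and
    the product of two general symbols never has to be written down. *)
Lemma I1_has_symbol a : I1 a -> exists p : int -> {poly K}, has_symbol a p.
Proof.
pose S := [set a : endo K | forall b,
  (exists p : int -> {poly K}, has_symbol b p) ->
  exists p : int -> {poly K}, has_symbol (a * b) p].
suff H : I1 `<=` S.
  by move=> /H/(_ 1)[|p]; [exists (fun k => (k == 0)%:R); apply: has_symbol1|
    rewrite mulr1; exists p].
apply: smallest_sub; last first.
  by move=> _ [[]|] -> b [p /[dup] + _]; [move/has_symbol_opX|
    move/has_symbol_opD|move/has_symbol_opI] => h; eexists; apply: h.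
split=> [|c u v|u v]; rewrite !in_setE.
- by move=> b; rewrite mul1r.
- move=> Su Sv b hb; have [p up] := Su _ hb; have [q vq] := Sv _ hb.
  exists (fun k => c *: p k + q k).
  by rewrite mulrDl -scalerAl; apply: has_symbol_lin.
by move=> Su Sv b hb; rewrite -mulrA; apply/Su/Sv.
Qed.

(** If only one pair of terms can contribute to the total shift [i + j], the
    coefficient of the product at that shift is a product of two values. The
    hypothesis holds both for the highest and for the lowest shifts. *)
Lemma symbol_corner a b (p q : int -> {poly K}) (i j : int) :
    has_symbol a p -> has_symbol b q ->
    (forall k l, k + l = i + j -> k <> i -> p k = 0 \/ q l = 0) ->
  exists N, forall s t, (N <= s)%N -> t%:Z = s%:Z + i + j ->
    dcoef t (b (a (dpow s))) = (q j).[s%:R + i%:~R] * (p i).[s%:R].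
Proof.
move=> [[B pB] [N aN]] [_ [M bM]] corner.
exists (N + M + B + `|i|)%N => s t hs et.
pose r := absz (s%:Z + i); have er : r%:Z = s%:Z + i by rewrite /r; lia.
pose R := maxn r.+1 (size (a (dpow s))).
rewrite [a (dpow s)](poly_dpow (leq_maxr r.+1 _)) -/R 2!linear_sum.
have hr : (r < R)%N by rewrite leq_maxl.
rewrite (bigD1 (Ordinal hr)) //= endoZ linearZ /= aN ?bM; try lia.
rewrite big1 ?addr0 => [|k nk].
  rewrite mulrC (_ : t%:Z - r%:Z = j); last by lia.
  rewrite (_ : r%:Z - s%:Z = i); last by lia.
  by rewrite [r%:R]pmulrn er rmorphD.
have {}nk : nat_of_ord k <> r by move=> e; case/eqP: nk; apply: val_inj.
rewrite endoZ linearZ /= aN; last by lia.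
have [kM|Mk] := ltnP k M; first by rewrite pB ?horner0 ?mul0r //; lia.
rewrite bM //; have [||->|->] := corner (k%:Z - s%:Z) (t%:Z - k%:Z).
- by lia.
- by move: nk er; lia.
- by rewrite horner0 mul0r.
- by rewrite horner0 mulr0.
Qed.

(** The equality of [symbol_corner] with the coefficients of the identity holds at
    all large naturals, hence as an identity of polynomials. *)
Lemma left_inverse_corner a b (p q : int -> {poly K}) (i j : int) :
    has_symbol a p -> has_symbol b q -> b * a = 1 ->
    (forall k l, k + l = i + j -> k <> i -> p k = 0 \/ q l = 0) ->
  (q j \Po ('X + (i%:~R)%:P)) * p i = (i + j == 0)%:R.
Proof.
move=> ap bq ba1 corner; have [N H] := symbol_corner ap bq corner.
apply: (@poly_eq_large (N + `|i| + `|j|)) => s hs.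
rewrite hornerM horner_comp hornerD hornerX hornerC.
have et : (absz (s%:Z + i + j))%:Z = s%:Z + i + j by lia.
rewrite -(H _ _ _ et); last by lia.
rewrite -endoE_mul ba1 endoE_one dcoef_dpow.
rewrite (_ : (_ == s) = (i + j == 0)); last by lia.
by case: eqP; rewrite ?hornerC ?horner0.
Qed.

Lemma exists_top (p : int -> {poly K}) :
    (exists B, forall k : int, (B < `|k|)%N -> p k = 0) ->
    (exists k, p k != 0) ->
  exists2 i, p i != 0 & forall k, i < k -> p k = 0.
Proof.
move=> [B pB] [k0 pk0].
pose P n := p (n%:Z - B%:Z) != 0.
have bnd (k : int) : p k != 0 -> (`|k| <= B)%N.
  by move=> pk; rewrite leqNgt; apply: contra pk => /pB ->.
have exP : exists n, P n.
  exists (absz (k0 + B%:Z)); rewrite /P.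
  by rewrite (_ : _ - _ = k0) //; have := bnd _ pk0; lia.
have ubP n : P n -> (n <= B + B)%N by move=> /bnd; lia.
case: (ex_maxnP exP ubP) => n Pn maxn; exists (n%:Z - B%:Z) => // k hk.
apply/eqP/negPn/negP => pk; have kB := bnd _ pk.
have := maxn (absz (k + B%:Z)); rewrite /P (_ : _ - _ = k); last by lia.
by move=> /(_ pk); lia.
Qed.

Lemma exists_bottom (p : int -> {poly K}) :
    (exists B, forall k : int, (B < `|k|)%N -> p k = 0) ->
    (exists k, p k != 0) ->
  exists2 i, p i != 0 & forall k, k < i -> p k = 0.
Proof.
move=> [B pB] [k0 pk0]; have [||i pi top] := @exists_top (fun k => p (- k)).
- by exists B => k hk; rewrite pB //; lia.
- by exists (- k0); rewrite opprK.
by exists (- i) => // k hk; rewrite -[k]opprK top //; lia.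
Qed.

(** Highest shifts [i], [j] and lowest shifts [i'], [j'] satisfy i + j = 0 and
    i' + j' = 0 because nonzero polynomials have a nonzero product; as i' <= i and
    j' <= j, both symbols have a single term. Two polynomials of product 1 are
    constant. *)
Lemma left_inverse_symbols a b (p q : int -> {poly K}) :
    has_symbol a p -> has_symbol b q -> b * a = 1 ->
  exists i lam, [/\ lam != 0, forall k, p k = (if k == i then lam%:P else 0)
    & forall k, q k = (if k == - i then (lam^-1)%:P else 0)].
Proof.
move=> ap bq ba1.
have nonzero : (exists k, p k != 0) /\ (exists k, q k != 0).
  apply: contrapT => /not_andP H.
  have vanish : (forall k, p k = 0) \/ (forall k, q k = 0).
    by case: H => H; [left|right] => k; apply/eqP/negPn/negP => h; apply: H;
      exists k.
  have corner k l : k + l = 0 + 0 :> int -> k <> 0 -> p k = 0 \/ q l = 0.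
    by move=> _ _; case: vanish => ->; [left|right].
  have /eqP := left_inverse_corner ap bq ba1 corner.
  by case: vanish => ->; rewrite ?comp_poly0 ?mulr0 ?mul0r addr0 eqxx
    eq_sym oner_eq0.
have [pfin _] := ap; have [qfin _] := bq.
have corner_nz i j : p i != 0 -> q j != 0 ->
    (forall k l, k + l = i + j -> k <> i -> p k = 0 \/ q l = 0) ->
    i + j = 0 /\ (q j \Po ('X + (i%:~R)%:P)) * p i = 1.
  move=> pi qj /(left_inverse_corner ap bq ba1).
  have : (q j \Po ('X + (i%:~R)%:P)) * p i != 0.
    rewrite mulf_neq0 // -size_poly_eq0 size_comp_poly2 ?size_poly_eq0 //.
    exact: size_XaddC.
  by move=> + e; rewrite e; case: (i + j =P 0) => [-> //|_]; rewrite eqxx.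
have [i pi ptop] := exists_top pfin nonzero.1.
have [j qj qtop] := exists_top qfin nonzero.2.
have [i' pi' pbot] := exists_bottom pfin nonzero.1.
have [j' qj' qbot] := exists_bottom qfin nonzero.2.
(* a shift away from the extreme one pushes the other factor past its extreme *)
have split_top k l : k + l = i + j -> k <> i -> p k = 0 \/ q l = 0.
  by move=> e ne; case: (ltP i k) => h;
    [left; apply: ptop|right; apply: qtop]; lia.
have split_bot k l : k + l = i' + j' -> k <> i' -> p k = 0 \/ q l = 0.
  by move=> e ne; case: (ltP k i') => h;
    [left; apply: pbot|right; apply: qbot]; lia.
have [ij qp1] := corner_nz _ _ pi qj split_top.
have [ij' _] := corner_nz _ _ pi' qj' split_bot.
have le_i : i' <= i by case: leP => // /pbot e; rewrite e eqxx in pi.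
have le_j : j' <= j by case: leP => // /qbot e; rewrite e eqxx in qj.
have /eqP : size (1 : {poly K}) = 1%N by rewrite size_poly1.
rewrite -{1}qp1 size_mul_eq1 size_comp_poly2; last exact: size_XaddC.
case/andP => /size_poly1P[mu _ qE] /size_poly1P[lam lam0 pE].
exists i, lam; split=> // k; case: eqP => [->|ne] //.
- by case: (ltP i k) => h; [apply: ptop|apply: pbot]; lia.
- rewrite (_ : - i = j); last by lia.
  rewrite qE; congr (_%:P); apply: (mulIf lam0); rewrite mulVf //.
  by apply: (@polyC_inj K); rewrite [RHS]polyC1 -qp1 qE pE comp_polyC polyCM.
by case: (ltP j k) => h; [apply: qtop|apply: qbot]; lia.
Qed.

Lemma symbol_eshift a (p : int -> {poly K}) lam m n (i : int) :
    has_symbol a p -> (forall k, p k = (if k == i then lam%:P else 0)) ->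
  i + m%:Z = n%:Z -> eshift lam m n a.
Proof.
move=> [_ [N aN]] pE e; exists N => s hs; apply: dcoefP => t.
rewrite linearZ /= dcoef_dpow aN ?pE; last by lia.
rewrite (_ : (t%:Z - (s + m)%N%:Z == i) = (t == s + n)%N); last by lia.
by case: eqP; rewrite ?hornerC ?horner0 ?mulr1 ?mulr0.
Qed.

(** A symbol with a single constant term is an eventual shift, and the two symbols
    sit at opposite shifts with inverse constants. *)
Lemma I1_inverse_eshift a b : I1 a -> I1 b -> b * a = 1 ->
  exists m n lam, [/\ lam != 0, eshift lam m n a & eshift lam^-1 n m b].
Proof.
move=> /I1_has_symbol[p ap] /I1_has_symbol[q bq] ba1.
have [i [lam [lam0 pE qE]]] := left_inverse_symbols ap bq ba1.
have [m [n e]] : exists m n : nat, i + m%:Z = n%:Z.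
  by exists (absz i), (absz (i + (absz i)%:Z)); lia.
exists m, n, lam; split=> //.
  exact: symbol_eshift ap pE e.
by apply: symbol_eshift bq qE _; lia.
Qed.

(** * Eventual shifts belong to I_1 *)

Lemma I1_subalg : GRing.subalg_closed [in @I1 K].
Proof.
split=> [|c a b|a b]; rewrite !in_setE.
- by move=> S [[S1 _ _] _]; move: S1; rewrite in_setE.
- move=> aI bI S SG; have [[_ Slin _] _] := SG.
  by have := Slin c a b; rewrite !in_setE; apply; [apply: aI|apply: bI].
- move=> aI bI S SG; have [[_ _ Smul] _] := SG.
  by have := Smul a b; rewrite !in_setE; apply; [apply: aI|apply: bI].
Qed.

Lemma I1_1 : I1 (1 : endo K).
Proof. by have [] := I1_subalg; rewrite in_setE. Qed.

Lemma I1_lin c a b : I1 a -> I1 b -> I1 (c *: a + b).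
Proof. by have [_ H _] := I1_subalg; have := H c a b; rewrite !in_setE; apply. Qed.

Lemma I1_mul a b : I1 a -> I1 b -> I1 (a * b).
Proof. by have [_ _ H] := I1_subalg; have := H a b; rewrite !in_setE; apply. Qed.

Lemma I1_0 : I1 (0 : endo K).
Proof. by rewrite -(addNr 1) -scaleN1r; apply: I1_lin; apply: I1_1. Qed.

Lemma I1_exp a n : I1 a -> I1 (a ^+ n).
Proof.
by move=> aI; elim: n => [|n IH]; rewrite ?exprS; [apply: I1_1|apply: I1_mul].
Qed.

Lemma I1_sum (I : finType) (F : I -> endo K) :
  (forall i, I1 (F i)) -> I1 (\sum_i F i).
Proof.
move=> FI; elim/big_ind: _ => // [|a b aI bI]; first exact: I1_0.
by rewrite -[a]scale1r; apply: I1_lin.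
Qed.

Lemma I1_opI : I1 (opI : endo K).
Proof. by apply: sub_gen_smallest; right. Qed.

Lemma I1_opD : I1 (opD : endo K).
Proof. by apply: sub_gen_smallest; left; right. Qed.

Lemma I1_block k l (G : 'M_(k, l)) lam : I1 (block G lam).
Proof.
have ID i j : I1 (opI ^+ i * opD ^+ j : endo K).
  exact: I1_mul (I1_exp i I1_opI) (I1_exp j I1_opD).
rewrite /block addrC; apply: I1_lin; first exact: ID.
apply: I1_sum => i; apply: I1_sum => j; rewrite -[_ *: _]addr0.
apply: I1_lin I1_0; rewrite /eI addrC -scaleN1r; apply: I1_lin; exact: ID.
Qed.

Lemma I1_eshift lam m n a : eshift lam m n a -> I1 a.
Proof. by move=> /eshift_blockP[k [l [G [_ ->]]]]; apply: I1_block. Qed.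

(** * One-sided inverses *)

Lemma endo_inverse a b :
  b * a = 1 -> injective a /\ forall q, exists p, b p = q.
Proof.
move=> ba1; have bK : cancel a b by move=> p; rewrite -endoE_mul ba1.
by split=> [|q]; [apply: can_inj bK|exists (a q)].
Qed.

(** int^n D^n is idempotent, and D^n int^n = 1 makes the two compressions of [c]
    carry the same information. *)
Lemma compressed_eq1 n (c : endo K) :
  opI ^+ n * opD ^+ n * c * opI ^+ n * opD ^+ n = opI ^+ n * opD ^+ n <->
  opD ^+ n * c * opI ^+ n = 1.
Proof.
split=> [/(congr1 (fun x => opD ^+ n * x * opI ^+ n))|e].
  by rewrite !mulrA !opDnIn !mul1r -!mulrA opDnIn mulr1 !mulrA.
by rewrite -!mulrA (mulrA (opD ^+ n) c) (mulrA (opD ^+ n * c)) e mul1r.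
Qed.

Lemma left_invertible_I1 a :
  I1 a /\ linv a !=set0 <->
    exists n a', [/\ KF a', a = a' * opI ^+ n & injective a].
Proof.
split=> [[aI [b [bI ba1]]]|[n [a' [a'KF aE inj]]]].
  have [inj _] := endo_inverse ba1.
  have [m [n [lam [lam0 aS _]]]] := I1_inverse_eshift aI bI ba1.
  have [mn _] := eshift_injective lam0 aS inj.
  have [|a' a'KF aE] := (KF_opI_eshift (n - m) a).2; last first.
    by exists (n - m)%N, a'.
  by exists lam => //; apply: eshift_reindex aS; rewrite subnKC.
have [|lam lam0 aS] := (KF_opI_eshift n a).1; first by exists a'.
have [_ [b bS ba1]] := eshift_injective lam0 aS inj.
by split; [apply: I1_eshift aS|exists b; split=> //; apply: I1_eshift bS].
Qed.

Lemma right_invertible_I1 b :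
  I1 b /\ rinv b !=set0 <->
    exists n b', [/\ KF b', b = opD ^+ n * b' & forall q, exists p, b p = q].
Proof.
split=> [[bI [a [aI ba1]]]|[n [b' [b'KF bE surj]]]].
  have [_ surj] := endo_inverse ba1.
  have [m [n [lam [lam0 _ bS]]]] := I1_inverse_eshift aI bI ba1.
  have lamV0 : lam^-1 != 0 by rewrite invr_eq0.
  have [mn _ _] := eshift_surjective lamV0 bS surj.
  have [|b' b'KF bE] := (opD_KF_eshift (n - m) b).2; last first.
    by exists (n - m)%N, b'.
  by exists lam^-1 => //; apply: eshift_reindex bS; rewrite addn0 subnK.
have [|lam lam0 bS] := (opD_KF_eshift n b).1; first by exists b'.
have [_ _ [a aS ba1]] := eshift_surjective lam0 bS surj.
by split; [apply: I1_eshift bS|exists a; split=> //; apply: I1_eshift aS].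
Qed.

Lemma dim_coker_KF_opI n a' a :
  KF a' -> a = a' * opI ^+ n -> injective a -> dim_coker a n.
Proof.
move=> a'KF aE inj.
have [|lam lam0 aS] := (KF_opI_eshift n a).1; first by exists a'.
have [_ [b bS ba1]] := eshift_injective lam0 aS inj.
have lamV0 : lam^-1 != 0 by rewrite invr_eq0.
have [_ surj] := endo_inverse ba1.
have [_ + _] := eshift_surjective lamV0 bS surj; rewrite subn0.
exact: dim_coker_left_inverse.
Qed.

Lemma dim_ker_opD_KF n b' b :
  KF b' -> b = opD ^+ n * b' -> (forall q, exists p, b p = q) -> dim_ker b n.
Proof.
move=> b'KF bE surj.
have [|lam lam0 bS] := (opD_KF_eshift n b).1; first by exists b'.
by have [_ + _] := eshift_surjective lam0 bS surj; rewrite subn0.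
Qed.

(** A left inverse of an eventual shift in I_1 is the opposite eventual shift, by
    uniqueness of the index, hence of the form D^n b'; the rest is
    [compressed_eq1]. *)
Lemma linv_KF_opI n a' : KF a' -> I1 (a' * opI ^+ n) ->
  linv (a' * opI ^+ n) =
    [set opD ^+ n * b' | b' in
      [set b' | KF b' /\
         opI ^+ n * opD ^+ n * b' * a' * opI ^+ n * opD ^+ n
         = opI ^+ n * opD ^+ n]].
Proof.
move=> a'KF; set a := a' * _ => aI.
have [|lam lam0 aS] := (KF_opI_eshift n a).1; first by exists a'.
apply/seteqP; split=> [b [bI ba1]|_ [b' [b'KF +] <-]].
  have [m [k [mu [mu0 aS' bS]]]] := I1_inverse_eshift aI bI ba1.
  have e := eshift_index lam0 aS aS'.
  have [|b' b'KF bE] := (opD_KF_eshift n b).2.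
    exists mu^-1; first by rewrite invr_eq0.
    by apply: eshift_reindex bS; lia.
  exists b' => //; split=> //.
  rewrite -(mulrA _ b' a'); apply/compressed_eq1.
  by rewrite mulrA -bE -mulrA.
rewrite -(mulrA _ b' a') => /compressed_eq1 e; split; last first.
  by rewrite /a -e !mulrA.
have [|mu mu0 /I1_eshift//] := (opD_KF_eshift n (opD ^+ n * b')).1.
by exists b'.
Qed.

Lemma rinv_opD_KF n b' : KF b' -> I1 (opD ^+ n * b') ->
  rinv (opD ^+ n * b') =
    [set a' * opI ^+ n | a' in
      [set a' | KF a' /\
         opI ^+ n * opD ^+ n * b' * a' * opI ^+ n * opD ^+ n
         = opI ^+ n * opD ^+ n]].
Proof.
move=> b'KF; set b := _ * b' => bI.
have [|lam lam0 bS] := (opD_KF_eshift n b).1; first by exists b'.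
apply/seteqP; split=> [a [aI ba1]|_ [a' [a'KF +] <-]].
  have [m [k [mu [mu0 aS bS']]]] := I1_inverse_eshift aI bI ba1.
  have e := eshift_index lam0 bS bS'.
  have [|a' a'KF aE] := (KF_opI_eshift n a).2.
    by exists mu => //; apply: eshift_reindex aS; lia.
  exists a' => //; split=> //.
  rewrite -(mulrA _ b' a'); apply/compressed_eq1.
  by rewrite mulrA -mulrA -aE.
rewrite -(mulrA _ b' a') => /compressed_eq1 e; split; last first.
  by rewrite /b -e !mulrA.
have [|mu mu0 /I1_eshift//] := (KF_opI_eshift n (a' * opI ^+ n)).1.
by exists a'.
Qed.

End CharacteristicZero.

Theorem corollary7p2 (K : fieldType) (charK : [pchar K] =i pred0) :
  [/\ forall a : endo K, I1 a ->
        (linv a !=set0 <->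
           exists n a', [/\ KF a', a = a' * opI ^+ n & injective a])
        /\
        (forall n a', KF a' -> a = a' * opI ^+ n -> injective a ->
           dim_coker a n /\
           linv a =
             [set opD ^+ n * b' | b' in
               [set b' | KF b' /\
                  opI ^+ n * opD ^+ n * b' * a' * opI ^+ n * opD ^+ n
                  = opI ^+ n * opD ^+ n]])
    , @LI1 K =
        [set a : endo K | (exists n a', KF a' /\ a = a' * opI ^+ n) /\
                          injective a]
    , forall b : endo K, I1 b ->
        (rinv b !=set0 <->
           exists n b', [/\ KF b', b = opD ^+ n * b'
                          & forall q, exists p, b p = q])
        /\
        (forall n b', KF b' -> b = opD ^+ n * b' ->
           (forall q, exists p, b p = q) ->
           dim_ker b n /\
           rinv b =
             [set a' * opI ^+ n | a' in
               [set a' | KF a' /\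
                  opI ^+ n * opD ^+ n * b' * a' * opI ^+ n * opD ^+ n
                  = opI ^+ n * opD ^+ n]])
    & @RI1 K =
        [set b : endo K | (exists n b', KF b' /\ b = opD ^+ n * b') /\
                          forall q, exists p, b p = q] ].
Proof.
split.
- move=> a aI; split.
    by split=> [h|/(left_invertible_I1 charK)[]//];
      apply/(left_invertible_I1 charK).
  move=> n a' a'KF aE inj; split; first exact: dim_coker_KF_opI aE inj.
  by rewrite aE in aI *; apply: linv_KF_opI.
- apply/seteqP; split=> [a [aI [b bI ba1]]|a [[n [a' [a'KF aE]]] inj]].
    have [|n [a' [a'KF aE inj]]] := (left_invertible_I1 charK a).1.
      by split=> //; exists b.
    by split=> //; exists n, a'.
  have [|aI [b [bI ba1]]] := (left_invertible_I1 charK a).2.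
    by exists n, a'.
  by split=> //; exists b.
- move=> b bI; split.
    by split=> [h|/(right_invertible_I1 charK)[]//];
      apply/(right_invertible_I1 charK).
  move=> n b' b'KF bE surj; split; first exact: dim_ker_opD_KF bE surj.
  by rewrite bE in bI *; apply: rinv_opD_KF.
- apply/seteqP; split=> [b [bI [a aI ba1]]|b [[n [b' [b'KF bE]]] surj]].
    have [|n [b' [b'KF bE surj]]] := (right_invertible_I1 charK b).1.
      by split=> //; exists a.
    by split=> //; exists n, b'.
  have [|bI [a [aI ba1]]] := (right_invertible_I1 charK b).2.
    by exists n, b'.
  by split=> //; exists a.
Qed.
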